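(* Let $\Gamma,\Delta$ be finite subsets of $For_2$ with $\Gamma\cup\Delta$ nonempty. If $\Gamma\Rightarrow\Delta$ is provable in the sequent calculus $\mathbf{B}$, then $\vDash_{\mathbf{B}_3}\Gamma\Rightarrow\Delta$. In particular, if $\Gamma\Rightarrow\alpha$ is provable in $\mathbf{B}$ then $\Gamma\vDash_{\mathbf{B}_3}\alpha$.
   Context: Fix a denumerable set $prop$ of propositional variables. $For_2$ is the set of formulas built from $prop$ with a unary connective $\lnot$ and a binary connective $\wedge$. $var(\alpha)$ is the set of propositional variables in $\alpha$; $var(\Gamma)=\bigcup_{\gamma\in\Gamma}var(\gamma)$. A sequent $\Gamma\Rightarrow\Delta$ is an ordered pair of finite sets of formulas, not both empty; $\alpha,\Gamma$ denotes $\Gamma\cup\{\alpha\}$. The calculus $\mathbf{B}$ has the axiom $\alpha\Rightarrow\alpha$ and the rules (premises / conclusion): (W$\Rightarrow$) $\Gamma\Rightarrow\Delta$ / $\alpha,\Gamma\Rightarrow\Delta$; ($\Rightarrow$W) $\Gamma\Rightarrow\Delta$ / $\Gamma\Rightarrow\Delta,\alpha$; (Cut) $\Gamma\Rightarrow\Delta,\alpha$ and $\alpha,\Gamma\Rightarrow\Delta$ / $\Gamma\Rightarrow\Delta$; ($\lnot\Rightarrow$) $\Gamma\Rightarrow\Delta,\alpha$ / $\lnot\alpha,\Gamma\Rightarrow\Delta$; ($\Rightarrow\lnot^B$) $\alpha,\Gamma\Rightarrow\Delta$ / $\Gamma\Rightarrow\Delta,\lnot\alpha$, allowed only if $var(\alpha)\subseteq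 var(\Gamma)$; ($\wedge\Rightarrow$) $\alpha_1,\alpha_2,\Gamma\Rightarrow\Delta$ / $\alpha_1\wedge\alpha_2,\Gamma\Rightarrow\Delta$; ($\Rightarrow\wedge$) $\Gamma\Rightarrow\Delta,\alpha_1$ and $\Gamma\Rightarrow\Delta,\alpha_2$ / $\Gamma\Rightarrow\Delta,\alpha_1\wedge\alpha_2$. Bochvar's logic $\mathbf{B}_3$ on $For_2$: truth values $\{1,\tfrac12,0\}$ with designated set $\{1\}$; valuations map $prop$ to $\{1,\tfrac12,0\}$ and extend by $\lnot1=0,\lnot\tfrac12=\tfrac12,\lnot0=1$, and $x\wedge y=\tfrac12$ if $x=\tfrac12$ or $y=\tfrac12$, otherwise classical conjunction. $\vDash_{\mathbf{B}_3}\Gamma\Rightarrow\Delta$ means: for every valuation $v$, if $v(\gamma)=1$ for all $\gamma\in\Gamma$ then $v(\delta)=1$ for some $\delta\in\Delta$. $\Gamma\vDash_{\mathbf{B}_3}\alpha$ means every valuation giving value $1$ to all of $\Gamma$ gives value $1$ to $\alpha$. *)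

(* Defs.v *)
From HB Require Import structures.
From mathcomp Require Import all_boot.
From mathcomp Require Import finmap.

Set Implicit Arguments.
Unset Strict Implicit.
Unset Printing Implicit Defensive.

Local Open Scope fset_scope.

Definition denumerable (T : Type) : Prop := exists f : nat -> T, bijective f.

Inductive formula (prop : Type) : Type :=
| Var of prop
| Neg of formula prop
| And of formula prop & formula prop.

Section FormulaChoice.
Variable prop : choiceType.

Fixpoint formula_encode (a : formula prop) : GenTree.tree prop :=
  match a with
  | Var p => GenTree.Leaf p
  | Neg b => GenTree.Node 0 [:: formula_encode b]
  | And b c => GenTree.Node 1 [:: formula_encode b; formula_encode c]
  end.

Fixpoint formula_decode (t : GenTree.tree prop) : option (formula prop) :=
  match t with
  | GenTree.Leaf p => Some (Var p)
  | GenTree.Node 0 [:: u] => omap (@Neg prop) (formula_decode u)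
  | GenTree.Node 1 [:: u; w] =>
      obind (fun b => omap (And b) (formula_decode w)) (formula_decode u)
  | _ => None
  end.

Lemma formula_encodeK : pcancel formula_encode formula_decode.
Proof. by elim=> [p|b /= ->|b /= -> c /= ->]. Qed.

HB.instance Definition _ := Choice.copy (formula prop) (pcan_type formula_encodeK).

End FormulaChoice.

Section Calculus.
Variable prop : choiceType.
Implicit Types (a : formula prop) (G D : {fset formula prop}).

Fixpoint var a : {fset prop} :=
  match a with
  | Var p => [fset p]
  | Neg b => var b
  | And b c => var b `|` var c
  end.

Definition vars G : {fset prop} := \bigcup_(g <- G) var g.

Record sequent : Type := Sequent {
  antecedent : {fset formula prop};
  succedent : {fset formula prop};
  _ : antecedent `|` succedent != fset0 }.

(* Every premise and conclusion is a sequent, hence carries a proof (n, n1, n2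
   for the premises, m for the conclusion) that its two sides are not both
   empty.  In particular Cut cannot conclude the empty sequent. *)
Inductive provable : sequent -> Prop :=
| Ax a m :
    provable (@Sequent [fset a] [fset a] m)
| WeakL a G D n m :
    provable (@Sequent G D n) ->
    provable (@Sequent (a |` G) D m)
| WeakR a G D n m :
    provable (@Sequent G D n) ->
    provable (@Sequent G (a |` D) m)
| Cut a G D n1 n2 m :
    provable (@Sequent G (a |` D) n1) ->
    provable (@Sequent (a |` G) D n2) ->
    provable (@Sequent G D m)
| NegL a G D n m :
    provable (@Sequent G (a |` D) n) ->
    provable (@Sequent (Neg a |` G) D m)
| NegR a G D n m :
    var a `<=` vars G ->
    provable (@Sequent (a |` G) D n) ->
    provable (@Sequent G (Neg a |` D) m)
| AndL a1 a2 G D n m :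
    provable (@Sequent (a1 |` (a2 |` G)) D n) ->
    provable (@Sequent (And a1 a2 |` G) D m)
| AndR a1 a2 G D n1 n2 m :
    provable (@Sequent G (a1 |` D) n1) ->
    provable (@Sequent G (a2 |` D) n2) ->
    provable (@Sequent G (And a1 a2 |` D) m).

End Calculus.

Inductive value : Type := One | Half | Zero.

Definition negv (x : value) : value :=
  match x with One => Zero | Half => Half | Zero => One end.

Definition andv (x y : value) : value :=
  match x, y with
  | Half, _ | _, Half => Half
  | One, One => One
  | _, _ => Zero
  end.

Fixpoint eval (prop : choiceType) (v : prop -> value) (a : formula prop) : value :=
  match a with
  | Var p => v p
  | Neg b => negv (eval v b)
  | And b c => andv (eval v b) (eval v c)
  end.

Definition B3_valid (prop : choiceType) (S : sequent prop) : Prop :=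
  forall v : prop -> value,
    (forall g, g \in antecedent S -> eval v g = One) ->
    exists2 d, d \in succedent S & eval v d = One.

Definition B3_entails (prop : choiceType) (G : {fset formula prop})
    (a : formula prop) : Prop :=
  forall v : prop -> value,
    (forall g, g \in G -> eval v g = One) -> eval v a = One.

(* Main.v *)
Require Import Defs.
From mathcomp Require Import all_boot.
From mathcomp Require Import finmap.

Local Open Scope fset_scope.

(** The value 1/2 is infectious: a formula takes it exactly when one of its
    variables does.  Hence a valuation designating every formula of [G] is
    two-valued on [vars G], which is what makes the restricted right negation
    rule sound. *)

Lemma eval_classicalP (prop : choiceType) (v : prop -> value) (a : formula prop) :
  eval v a <> Half <-> (forall p, p \in var a -> v p <> Half).
Proof.
elim: a => [p|b IHb|b IHb c IHc] /=.
- by split=> [vp q /fset1P -> //|]; apply; rewrite fset11.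
- by rewrite -IHb; case: (eval v b).
- split=> [bc p|vbc].
  (* A conjunction avoids [Half] only if both conjuncts do, so the induction hypothesis of whichever
     conjunct contains [p] applies. *)
  + by rewrite in_fsetU => /orP[]; move: p; [apply/IHb | apply/IHc];
      move: bc; case: (eval v b); case: (eval v c).
  + have /IHb: forall p, p \in var b -> v p <> Half.
      by move=> p pb; apply: vbc; rewrite in_fsetU pb.
    have /IHc: forall p, p \in var c -> v p <> Half.
      by move=> p pc; apply: vbc; rewrite in_fsetU pc orbT.
    by case: (eval v b); case: (eval v c).
Qed.

(** Each variable of [a] occurs in some [g] of [G]; since [g] has value [One], that variable is not
    [Half]. This is how the proviso of [NegR] is used. *)
Lemma eval_vars_classical (prop : choiceType) (v : prop -> value)
    (G : {fset formula prop}) (a : formula prop) :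
  var a `<=` vars G -> (forall g, g \in G -> eval v g = One) ->
  eval v a <> Half.
Proof.
move=> /fsubsetP aG vG; apply/eval_classicalP => p /aG.
case/bigfcupP=> g; rewrite andbT => gG; move: p.
by apply/eval_classicalP; rewrite vG.
Qed.

Lemma designates_fset1U (prop : choiceType) (v : prop -> value)
    (G : {fset formula prop}) (a : formula prop) :
  (forall g, g \in a |` G -> eval v g = One) <->
  eval v a = One /\ (forall g, g \in G -> eval v g = One).
Proof.
split=> [vaG|[va vG] g /fset1UP[-> //|/vG //]].
by split=> [|g gG]; apply: vaG; rewrite ?fset1U1 ?fset1Ur.
Qed.

Lemma some_designated_fset1U (prop : choiceType) (v : prop -> value)
    (D : {fset formula prop}) (a : formula prop) :
  (exists2 d, d \in a |` D & eval v d = One) <->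
  eval v a = One \/ (exists2 d, d \in D & eval v d = One).
Proof.
split=> [[d /fset1UP[->|dD] vd]|[va|[d dD vd]]].
- by left.
- by right; exists d.
- by exists a; rewrite ?fset1U1.
- by exists d; rewrite ?fset1Ur.
Qed.

(** Induction on the derivation: each rule preserves validity under a fixed valuation [v]. *)
Lemma provable_B3_valid (prop : choiceType) (S : sequent prop) :
  provable S -> B3_valid S.
Proof.
elim=> {S} [a m|a G D n m _ IH|a G D n m _ IH|a G D n1 n2 m _ IH1 _ IH2
  |a G D n m _ IH|a G D n m aG _ IH|a1 a2 G D n m _ IH
  |a1 a2 G D n1 n2 m _ IH1 _ IH2] v /=.
- by move=> va; exists a; [rewrite fset11 | apply: va; rewrite fset11].
- by move=> /designates_fset1U[_ vG]; apply: IH.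
- by move=> vG; apply/some_designated_fset1U; right; apply: IH.
(* Cut: if the first premise designates only the cut formula, [v] satisfies the antecedent of the
   second. *)
- move=> vG; have /some_designated_fset1U[va|//] := IH1 v vG.
  by apply: IH2; apply/designates_fset1U.
- move=> /designates_fset1U[/= vNa vG].
  have /some_designated_fset1U[va|//] := IH v vG.
  (* [a] and [Neg a] are never both designated. *)
  by rewrite va in vNa.
- move=> vG; apply/some_designated_fset1U => /=.
  (* With [Half] excluded, either [a] is [Zero] and [Neg a] is designated, or [a] is [One] and the
     premise applies. *)
  have := eval_vars_classical _ v _ _ aG vG.
  case va: (eval v a) => // _; last by left.
  by right; apply: IH; apply/designates_fset1U.
- move=> /designates_fset1U[/= va vG]; apply: IH => /=.
  (* [andv] yields [One] only on two arguments [One]. *)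
  apply/designates_fset1U; rewrite designates_fset1U; move: va.
  by case: (eval v a1); case: (eval v a2).
- move=> vG; apply/some_designated_fset1U => /=.
  have /some_designated_fset1U[->|] := IH1 v vG; last by right.
  by have /some_designated_fset1U[->|] := IH2 v vG; [left | right].
Qed.

Theorem mainTheorem4 (prop : choiceType) (hprop : denumerable prop) :
  (forall (G D : {fset formula prop}) (ne : G `|` D != fset0),
      provable (@Sequent prop G D ne) -> B3_valid (@Sequent prop G D ne)) /\
  (forall (G : {fset formula prop}) (a : formula prop)
          (ne : G `|` [fset a] != fset0),
      provable (@Sequent prop G [fset a] ne) -> B3_entails G a).
Proof.
split=> [G D ne|G a ne] /provable_B3_valid // valid v vG.
(* The designated member of a singleton succedent can only be [a]. *)
by have [d /fset1P ->] := valid v vG.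
Qed.
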